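(* Let $\mathcal{H}$ be a Hilbert space and $\mathcal{G}$ a normed space. Let $I=\{1,\dots,m\}$, $I_0=\{m+1,\dots,n\}$ (possibly $I_0=\emptyset$), and let $h_i:\mathcal{G}\times\mathcal{H}\to\mathbb{R}$, $i=1,\dots,n$, be jointly continuous functions whose partial gradients $\nabla_x h_i$ are jointly continuous. Define $F(p)=\{x\in\mathcal{H}\mid h_i(p,x)\le 0,\ i\in I,\ h_i(p,x)=0,\ i\in I_0\}$ and let $(p^0,x^0)\in\mathrm{gr}F$. Assume: 1) $F$ is lower semicontinuous at $(p^0,x^0)$ relative to $\mathrm{dom}F$; 2) $F$ satisfies RCRCQ at $(p^0,x^0)$ relative to $\mathrm{dom}F\times\mathcal{H}$. Then $F$ is R-regular at $(p^0,x^0)$ relative to $\mathrm{dom}F$.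
   Context: $\mathrm{dom}F=\{p\mid F(p)\neq\emptyset\}$, $\mathrm{gr}F=\{(p,x)\mid x\in F(p)\}$. $F$ is lower semicontinuous at $(p^0,x^0)$ relative to $P$ if for every neighbourhood $V(x^0)$ there is a neighbourhood $V(p^0)$ with $F(p)\cap V(x^0)\neq\emptyset$ for all $p\in V(p^0)\cap P$. Let $I(p,x)=\{i\in I\mid h_i(p,x)=0\}$. $F$ satisfies RCRCQ at $(p^0,x^0)$ relative to $P\times X$ if for every $K\subset I(p^0,x^0)$, $\mathrm{rank}\{\nabla_x h_i(p,x): i\in I_0\cup K\}=\mathrm{rank}\{\nabla_x h_i(p^0,x^0): i\in I_0\cup K\}$ for all $(p,x)\in P\times X$ in some neighbourhood of $(p^0,x^0)$. $F$ is R-regular at $(p^0,x^0)$ relative to $P$ if there exist $M>0$ and neighbourhoods $V(p^0)$, $V(x^0)$ such that $\mathrm{dist}(x,F(p))\le M\max\{0,\ h_i(p,x)\ (i\in I),\ |h_i(p,x)|\ (i\in I_0)\}$ for all $x\in V(x^0)$ and $p\in V(p^0)\cap P$. *)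

(* Defs.v *)
From HB Require Import structures.
From mathcomp Require Import all_boot all_order all_algebra.
From mathcomp Require Import all_classical all_reals all_analysis.
Set Implicit Arguments. Unset Strict Implicit. Unset Printing Implicit Defensive.
Import Order.TTheory GRing.Theory Num.Theory.
Import numFieldNormedType.Exports.
Local Open Scope classical_set_scope.
Local Open Scope ring_scope.

(* ip is an inner product on H inducing the norm of H; together with
   completeness of H (completeNormedModType) this makes H a Hilbert space. *)
Definition is_inner_product {R : realType} {H : normedModType R}
  (ip : H -> H -> R) : Prop :=
  [/\ (forall x y, ip x y = ip y x),
      (forall (a : R) x y z, ip (a *: x + y) z = a * ip x z + ip y z)
    & (forall x, ip x x = `|x| ^+ 2)].

Definition is_partial_gradient {R : realType} {G : normedModType R}
  {H : normedModType R} (ip : H -> H -> R) (h : G -> H -> R)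
  (gh : G -> H -> H) : Prop :=
  forall p x, differentiable (h p) x /\ ('d (h p) x : H -> R) = ip (gh p x).

(* Constraint indices are 'I_n; i < m is I = {1..m}, m <= i is I0 = {m+1..n}. *)
Definition feasible_map {R : realType} {G : normedModType R} {H : normedModType R}
  (m n : nat) (h : 'I_n -> G -> H -> R) (p : G) : set H :=
  [set x | (forall i : 'I_n, (i < m)%N -> h i p x <= 0) /\
           (forall i : 'I_n, (m <= i)%N -> h i p x = 0)].

Definition domain {A B : Type} (F : A -> set B) : set A :=
  [set p | F p !=set0].

Definition graph {A B : Type} (F : A -> set B) : set (A * B) :=
  [set q | F q.1 q.2].

Definition lsc_rel {R : realType} {G : normedModType R} {H : normedModType R}
  (F : G -> set H) (P : set G) (p0 : G) (x0 : H) : Prop :=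
  forall V, nbhs x0 V ->
    exists2 U, nbhs p0 U & forall p, U p -> P p -> F p `&` V !=set0.

Definition active {R : realType} {G : normedModType R} {H : normedModType R}
  (m n : nat) (h : 'I_n -> G -> H -> R) (p : G) (x : H) : {set 'I_n} :=
  [set i : 'I_n | (i < m)%N && `[< h i p x = 0 >]].

Definition eq_indices (m n : nat) : {set 'I_n} := [set i : 'I_n | (m <= i)%N].

Definition lin_indep {R : realType} {H : normedModType R} (n : nat)
  (v : 'I_n -> H) (T : {set 'I_n}) : Prop :=
  forall c : 'I_n -> R, \sum_(i in T) c i *: v i = 0 ->
    forall i, i \in T -> c i = 0.

Definition fam_rank {R : realType} {H : normedModType R} (n : nat)
  (v : 'I_n -> H) (S : {set 'I_n}) : nat :=
  \max_(T : {set 'I_n} | (T \subset S) && `[< lin_indep v T >]) #|T|.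

Definition RCRCQ_rel {R : realType} {G : normedModType R} {H : normedModType R}
  (m n : nat) (h : 'I_n -> G -> H -> R) (gh : 'I_n -> G -> H -> H)
  (P : set G) (X : set H) (p0 : G) (x0 : H) : Prop :=
  forall K : {set 'I_n}, K \subset active m h p0 x0 ->
    \forall q \near (p0, x0), P q.1 -> X q.2 ->
      fam_rank (fun i => gh i q.1 q.2) (eq_indices m n :|: K) =
      fam_rank (fun i => gh i p0 x0) (eq_indices m n :|: K).

Definition dist_set {R : realType} {H : normedModType R} (x : H) (A : set H) : R :=
  inf [set `|x - y| | y in A].

Definition residual {R : realType} {G : normedModType R} {H : normedModType R}
  (m n : nat) (h : 'I_n -> G -> H -> R) (p : G) (x : H) : R :=
  \big[Num.max/0]_(i < n) (if (i < m)%N then h i p x else `|h i p x|).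

Definition R_regular_rel {R : realType} {G : normedModType R} {H : normedModType R}
  (m n : nat) (h : 'I_n -> G -> H -> R) (P : set G) (p0 : G) (x0 : H) : Prop :=
  exists M : R, 0 < M /\
    exists2 U, nbhs p0 U & exists2 V, nbhs x0 V &
      forall x p, V x -> U p -> P p ->
        dist_set x (feasible_map m h p) <= M * residual m h p x.

(* Main.v *)
(* Fix p in dom F near p0 and x near x0, and let psi denote the residual.
   Ekeland's principle applied to the penalised projection
   z |-> |z - x|^2/2 + (k/2) sum_i violation_i(z)^2, started at a feasible point
   near x0 (lower semicontinuity), gives z with
   x - z = sum_i k violation_i(z) grad h_i(p, z) + (an error of norm <= psi).
   The inequality multipliers are nonnegative and charge only violated
   constraints.  By Caratheodory they can be moved to a family of gradients that
   is linearly independent at (p, z); constant rank makes it independent at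
   (p0, x0) as well, so the new multipliers are bounded uniformly.  Pairing with
   x - z and linearising yields |z - x| <= C psi(x), while psi(z) <= psi(x)/2
   for k large.  Such a descent step, available wherever psi > 0, gives the
   error bound by Ekeland's principle applied to psi itself. *)

Require Import Defs.
From HB Require Import structures.
From mathcomp Require Import all_boot all_order all_algebra.
From mathcomp Require Import all_classical all_reals all_analysis.
From mathcomp Require Import ring lra.
Import Order.TTheory GRing.Theory Num.Theory.
Import numFieldNormedType.Exports.
Local Open Scope classical_set_scope.
Local Open Scope ring_scope.

(** * Inner product identities and the Cauchy-Schwarz inequality *)

Lemma ip_props {R : realType} {H : normedModType R} {ip : H -> H -> R} :
  is_inner_product ip ->
  [/\ (forall x y z, ip (x + y) z = ip x z + ip y z),
      (forall a x z, ip (a *: x) z = a * ip x z),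
      (forall x y z, ip z (x + y) = ip z x + ip z y)
    & (forall a x z, ip z (a *: x) = a * ip z x)].
Proof.
move=> [ipC ipL _].
have ipD x y z : ip (x + y) z = ip x z + ip y z.
  by rewrite -[x in LHS]scale1r ipL mul1r.
have ip0 z : ip 0 z = 0.
  by apply: (addrI (ip 0 z)); rewrite -ipD !addr0.
have ipZ a x z : ip (a *: x) z = a * ip x z.
  by rewrite -[_ *: _]addr0 ipL ip0 addr0.
by split=> // [x y z|a x z]; rewrite !(ipC z) ?ipD ?ipZ.
Qed.

Lemma ip_suml {R : realType} {H : normedModType R} {ip : H -> H -> R}
    (I : finType) (P : pred I) (F : I -> H) (z : H) :
  is_inner_product ip ->
  ip (\sum_(i | P i) F i) z = \sum_(i | P i) ip (F i) z.
Proof.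
move=> /ip_props [ipD ipZ _ _].
apply: (big_morph (ip^~ z)) => [x y|]; first exact: ipD.
by rewrite -(scale0r z) ipZ mul0r.
Qed.

Lemma ip_normD {R : realType} {H : normedModType R} {ip : H -> H -> R}
    (x y : H) : is_inner_product ip ->
  `|x + y| ^+ 2 = `|x| ^+ 2 + 2 * ip x y + `|y| ^+ 2.
Proof.
move=> hip; have [ipD _ ipDr _] := ip_props hip; case: hip => ipC _ ipN.
by rewrite -!ipN ipD !ipDr (ipC y x); ring.
Qed.

Lemma cauchy_schwarz {R : realType} {H : normedModType R} {ip : H -> H -> R}
    (x y : H) : is_inner_product ip -> `|ip x y| <= `|x| * `|y|.
Proof.
move=> hip; have [_ ipZ _ ipZr] := ip_props hip.
have ub (u v : H) : ip u v <= `|u| * `|v|.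
  have [->|u0] := eqVneq u 0.
    by rewrite -[X in ip X](scale0r 0) ipZ mul0r normr0 mul0r.
  have [->|v0] := eqVneq v 0.
    by rewrite -[X in ip _ X](scale0r 0) ipZr mul0r normr0 mulr0.
  have : 0 <= `| `|v| *: u + (- `|u|) *: v| ^+ 2 by rewrite exprn_ge0.
  rewrite (ip_normD _ _ hip) ipZ ipZr !normrZ normrN !normr_id.
  have : 0 < `|u| * `|v| by rewrite mulr_gt0 ?normr_gt0.
  by move: (`|u|) (`|v|) (ip u v) => a b c ab; nra.
rewrite ler_norml ub andbT lerNl -mulN1r -ipZ (le_trans (ub _ _)) //.
by rewrite scaleN1r normrN.
Qed.

(** * Independence, span and rank of finite families *)

Lemma lin_indep_enum {R : realType} {H : normedModType R} {n : nat}
    {v : 'I_n -> H} {T : {set 'I_n}} {u : 'I_#|T| -> R} :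
  lin_indep v T -> \sum_(k < #|T|) u k *: v (enum_val k) = 0 ->
  forall k, u k = 0.
Proof.
move=> vT u0 k.
(* Each fibre of [enum_val] has at most one element, so this sum extends [u] by zero to all
   indices. *)
pose c i := \sum_(l | enum_val l == i) u l.
have cE (l : 'I_#|T|) : c (enum_val l) = u l.
  rewrite /c (eq_bigl (pred1 l)) ?big_pred1_eq // => l' /=.
  by rewrite (inj_eq enum_val_inj).
rewrite -cE; apply: vT; last exact: enum_valP.
by rewrite big_enum_val -[RHS]u0; apply: eq_bigr => l _; rewrite cE.
Qed.

(** Steinitz: if [W] were larger, the coefficient matrix would have more rows than columns, and a
    vector of its left kernel would be a relation on [W]. *)
Lemma lin_indep_card_le {R : realType} {H : normedModType R} {n : nat}
    (v : 'I_n -> H) (T W : {set 'I_n}) (a : 'I_n -> 'I_n -> R) :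
  (forall i, i \in W -> v i = \sum_(j in T) a i j *: v j) ->
  lin_indep v W -> (#|W| <= #|T|)%N.
Proof.
move=> va vW; rewrite leqNgt; apply/negP => TW.
pose A := \matrix_(i < #|W|, j < #|T|) a (enum_val i) (enum_val j).
have /rowV0Pn[u /sub_kermxP uA u0] : kermx A != 0.
  rewrite kermx_eq0 /row_free; apply/eqP => rA.
  by move: (rank_leq_col A); rewrite rA leqNgt TW.
suff uv0 : \sum_(l < #|W|) u 0 l *: v (enum_val l) = 0.
  by move/eqP: u0; apply; apply/rowP => l; rewrite (lin_indep_enum vW uv0) mxE.
transitivity (\sum_(l < #|W|) \sum_(j < #|T|)
    (u 0 l * A l j) *: v (enum_val j)).
  apply: eq_bigr => l _; rewrite va ?enum_valP// big_enum_val scaler_sumr.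
  by apply: eq_bigr => j _; rewrite scalerA mxE.
rewrite exchange_big /= big1 // => j _.
rewrite -scaler_suml.
by have /matrixP/(_ 0 j) := uA; rewrite !mxE => ->; rewrite scale0r.
Qed.

Lemma lin_indepPn {R : realType} {H : normedModType R} {n : nat}
    (v : 'I_n -> H) (T : {set 'I_n}) :
  ~ lin_indep v T ->
  exists c, \sum_(i in T) c i *: v i = 0 /\ exists2 k, k \in T & c k != 0.
Proof.
move=> /existsNP[c /not_implyP[c0 /existsNP[k /not_implyP[kT /eqP ck]]]].
by exists c; split=> //; exists k.
Qed.

Lemma fam_rank_witness {R : realType} {H : normedModType R} {n : nat}
    (v : 'I_n -> H) (S : {set 'I_n}) :
  exists T : {set 'I_n}, [/\ T \subset S, lin_indep v T & #|T| = fam_rank v S].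
Proof.
have [] := @eq_bigmax_cond _
   [pred T : {set 'I_n} | (T \subset S) && `[< lin_indep v T >]]
   (fun T : {set 'I_n} => #|T|).
  apply/card_gt0P; exists finset.set0; rewrite inE finset.sub0set /=; apply/asboolP.
  by move=> c _ i; rewrite inE.
by move=> T /andP[TS /asboolP vT] TE; exists T; split; rewrite // -TE.
Qed.

Lemma fam_rank_ge {R : realType} {H : normedModType R} {n : nat}
    (v : 'I_n -> H) (S T : {set 'I_n}) :
  T \subset S -> lin_indep v T -> (#|T| <= fam_rank v S)%N.
Proof.
move=> TS vT.
rewrite /fam_rank; apply: (@leq_bigmax_cond _ _ (fun T : {set 'I_n} => #|T|)).
by rewrite TS; apply/asboolP.
Qed.

(** By maximality of [T], adding any [i] of [S] creates a relation; its coefficient at [i] is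
    nonzero, since otherwise it would be a relation on [T], so it can be solved for [v i]. *)
Lemma fam_rank_span {R : realType} {H : normedModType R} {n : nat}
    (v : 'I_n -> H) (S T : {set 'I_n}) :
  T \subset S -> lin_indep v T -> (fam_rank v S <= #|T|)%N ->
  exists a : 'I_n -> 'I_n -> R,
    forall i, i \in S -> v i = \sum_(j in T) a i j *: v j.
Proof.
move=> TS vT rT.
suff /choice[a aP] : forall i, exists a : 'I_n -> R, i \in S ->
    v i = \sum_(j in T) a j *: v j by exists a.
move=> i; have [iS|] := boolP (i \in S); last by exists (fun=> 0).
have [iT|iT] := boolP (i \in T).
  exists (fun j => (j == i)%:R) => _; rewrite (bigD1 i)//= eqxx scale1r.
  by rewrite big1 ?addr0// => j /andP[_ /negPf->]; rewrite scale0r.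
have : ~ lin_indep v (i |: T).
  move=> /fam_rank_ge => /(_ S); rewrite finset.subUset finset.sub1set iS TS => /(_ isT).
  by rewrite cardsU1 iT add1n => h; have := leq_trans h rT; rewrite ltnn.
move=> /lin_indepPn[c []]; rewrite big_setU1 //= => c0 [k kiT ck].
have ci : c i != 0.
  apply: contra_neq ck => ci; move: c0; rewrite ci scale0r add0r => /vT h.
  by move: kiT; rewrite !inE => /orP[/eqP->|/h].
exists (fun j => - ((c i)^-1 * c j)) => _.
move: c0 => /(congr1 (fun z => (c i)^-1 *: z)).
rewrite scaler0 scalerDr scalerA mulVf// scale1r => /eqP.
rewrite addr_eq0 => /eqP->; rewrite scaler_sumr -sumrN.
by apply: eq_bigr => j _; rewrite scaleNr scalerA.
Qed.

Lemma lin_dep_span {R : realType} {H : normedModType R} {n : nat}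
    (v : 'I_n -> H) (T : {set 'I_n}) : 
  ~ lin_indep v T -> exists2 k, k \in T &
  exists a : 'I_n -> 'I_n -> R,
    forall i, i \in T -> v i = \sum_(j in T :\ k) a i j *: v j.
Proof.
move=> /lin_indepPn[c [c0 [k kT ck]]]; exists k => //.
exists (fun i j => if i == k then - ((c k)^-1 * c j) else (j == i)%:R) => i iT.
have [->{i iT}|ik] := eqVneq i k.
  move: c0; rewrite (big_setD1 k)//= => /(congr1 (fun z => (c k)^-1 *: z)).
  rewrite scaler0 scalerDr scalerA mulVf// scale1r => /eqP.
  rewrite addr_eq0 => /eqP->; rewrite scaler_sumr -sumrN.
  by apply: eq_bigr => j _; rewrite scaleNr scalerA.
rewrite (bigD1 i) ?inE ?ik//= eqxx scale1r big1 ?addr0// => j /andP[_ /negPf->].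
by rewrite scale0r.
Qed.

(** If [T] were dependent, one of its vectors could be dropped without losing the span, and a
    maximal independent family in [S] would be larger than a family spanning it. *)
Lemma lin_indep_of_span {R : realType} {H : normedModType R} {n : nat}
    (v : 'I_n -> H) (S T : {set 'I_n}) (a : 'I_n -> 'I_n -> R) :
  (forall i, i \in S -> v i = \sum_(j in T) a i j *: v j) ->
  (#|T| <= fam_rank v S)%N -> lin_indep v T.
Proof.
move=> va rT; apply: contrapT => /lin_dep_span[k kT [b vb]].
have [W [WS vW WE]] := fam_rank_witness v S.
pose d i j := \sum_(l in T) a i l * b l j.
have : (#|W| <= #|T :\ k|)%N.
  apply: (lin_indep_card_le _ _ _ d _ vW) => i /(fintype.subsetP WS) iS.
  rewrite va //.
  under eq_bigr => l lT do rewrite vb// scaler_sumr.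
  rewrite exchange_big /=; apply: eq_bigr => j _.
  by rewrite /d scaler_suml; apply: eq_bigr => l _; rewrite scalerA.
rewrite WE => h; have := leq_trans rT h.
by rewrite [X in (X <= _)%N](cardsD1 k) kT ltnn.
Qed.

(* Carathéodory: only indices of K are discarded, those of T0 carry signed
   coefficients. *)
Lemma caratheodory {R : realType} {H : normedModType R} {n : nat}
    (v : 'I_n -> H) (T0 K : {set 'I_n}) (c : 'I_n -> R) :
  lin_indep v T0 -> (forall i, i \in K -> i \notin T0) ->
  (forall i, i \in K -> 0 <= c i) ->
  exists (K' : {set 'I_n}) (c' : 'I_n -> R),
    [/\ K' \subset K, lin_indep v (T0 :|: K'),
        (forall i, i \in K' -> 0 <= c' i)
      & \sum_(i in T0 :|: K') c' i *: v i = \sum_(i in T0 :|: K) c i *: v i].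
Proof.
move=> vT0.
have [k] := ubnP #|K|; elim: k => // k IH in K c * => Kk dK c0.
have [vK|] := pselect (lin_indep v (T0 :|: K)).
  by exists K, c; split.
move=> /lin_indepPn[b [b0 [l lTK bl]]].
(* The relation must charge [K], because [T0] alone is independent. *)
have [j jK bj] : exists2 j, j \in K & b j != 0.
  apply: contrapT => nj; have bK j : j \in K -> b j = 0.
    by move=> jK; apply/eqP; apply: contraT => bj; exfalso; apply: nj; exists j.
  have b0' : \sum_(i in T0) b i *: v i = 0.
    rewrite -[RHS]b0 [LHS]big_mkcond [RHS]big_mkcond /=.
    apply: eq_bigr => i _; rewrite inE; case: (i \in T0) => //=.
    by case: ifP => // /bK->; rewrite scale0r.
  move/eqP: bl; apply.
  by move: lTK; rewrite inE => /orP[|/bK//]; exact: vT0 b0' l.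
wlog bj0 : b b0 {l lTK bl} bj / 0 < b j => [W|].
  move: (bj); rewrite neq_lt => /orP[bj0|bj0]; last exact: (W b).
  apply: (W (fun i => - b i)); rewrite ?oppr_eq0 ?oppr_gt0//.
  by under eq_bigr do rewrite scaleNr; rewrite sumrN b0 oppr0.
pose P := [pred i | (i \in K) && (0 < b i)].
have Pj : P j by rewrite /= jK bj0.
(* Subtract [t] times the relation, [t] being the least ratio [c i / b i] over [b i > 0]: the
   coefficients on [K] stay nonnegative and the one at [s] vanishes. *)
case: (arg_minP (fun i => c i / b i) Pj) => s /andP[sK bs] sm.
pose t := c s / b s; pose c' i := c i - t * b i.
have cs : c' s = 0 by rewrite /c' /t divfK ?subrr// gt_eqF.
have t0 : 0 <= t by rewrite divr_ge0 ?c0 // ltW.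
have [||i|K' [d [K'K vK' d0 dE]]] := IH (K :\ s) c'.
- by move: Kk; rewrite (cardsD1 s) sK ltnS.
- by move=> i; rewrite !inE => /andP[_ /dK].
- rewrite !inE => /andP[_ iK]; rewrite /c' subr_ge0.
  have [bi|bi] := ltP 0 (b i).
    by rewrite -ler_pdivlMr//; apply: sm; rewrite /= iK bi.
  by apply: le_trans (c0 _ iK); rewrite mulr_ge0_le0.
exists K', d; split => //; first by rewrite (fintype.subset_trans K'K)// finset.subD1set.
have sT0 : s \notin T0.
  exact: dK.
rewrite dE; transitivity (\sum_(i in T0 :|: K) c' i *: v i).
  rewrite [RHS](big_setD1 s) /=; last by rewrite inE sK orbT.
  rewrite cs scale0r add0r; apply: eq_bigl => i.
  by rewrite !inE; case: eqVneq => [->|]//=; rewrite (negPf sT0).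
under eq_bigr do rewrite /c' scalerBl -scalerA.
by rewrite sumrB -scaler_sumr b0 scaler0 subr0.
Qed.

(** * Coefficient bounds stable under perturbation *)

(** The Gram matrix is invertible: a combination given by a kernel vector is orthogonal to the whole
    family, hence to itself. The columns of the inverse give the biorthogonal family. *)
Lemma lin_indep_dual {R : realType} {H : normedModType R} {ip : H -> H -> R}
    {n : nat} (v : 'I_n -> H) (T : {set 'I_n}) :
  is_inner_product ip -> lin_indep v T ->
  exists w : 'I_#|T| -> H,
    forall k l, ip (v (enum_val k)) (w l) = (k == l)%:R.
Proof.
move=> hip vT; have [_ ipZ _ _] := ip_props hip; have [ipC _ ipN] := hip.
pose V (k : 'I_#|T|) := v (enum_val k).
pose Gram := \matrix_(k, l) ip (V k) (V l).
have GramU : Gram \in unitmx.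
  rewrite -row_free_unit; apply: inj_row_free => u uG.
  pose z := \sum_k u 0 k *: V k.
  have zV l : ip z (V l) = 0.
    have /matrixP/(_ 0 l) := uG; rewrite !mxE => <-.
    by rewrite ip_suml//; apply: eq_bigr => k _; rewrite ipZ mxE.
  have : z = 0.
    apply/eqP; rewrite -normr_eq0 -sqrf_eq0 -ipN {1}/z ip_suml//.
    by rewrite big1// => k _; rewrite ipZ ipC zV mulr0.
  by move=> /(lin_indep_enum vT) u0; apply/rowP => k; rewrite u0 mxE.
exists (fun l => \sum_k invmx Gram k l *: V k) => k l.
rewrite ipC ip_suml//; have /matrixP/(_ k l) := mulmxV GramU; rewrite !mxE => <-.
by apply: eq_bigr => j _; rewrite ipZ mulrC mxE ipC.
Qed.

(** Pairing with the biorthogonal family of [v0] recovers each coefficient up to an error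
    proportional to the sum of all [|c i|]; for [v] close to [v0] this error is absorbed on the
    left. The same [k] is the bound and the inverse of the admissible radius. *)
Lemma lin_indep_coef_le {R : realType} {H : normedModType R} {ip : H -> H -> R}
    {n : nat} (v0 : 'I_n -> H) (T : {set 'I_n}) :
  is_inner_product ip -> lin_indep v0 T ->
  exists2 k : R, 0 < k & forall v, (forall i, `|v i - v0 i| <= k^-1) ->
    forall c : 'I_n -> R, \sum_(i in T) `|c i| <= k * `|\sum_(i in T) c i *: v i|.
Proof.
move=> hip v0T; have [ipD ipZ _ _] := ip_props hip.
have [w wP] := lin_indep_dual v0 T hip v0T.
pose W : R := 1 + \sum_l `|w l|.
have W1 : 1 <= W by rewrite lerDl sumr_ge0.
have wW l : `|w l| <= W.
  by rewrite /W (bigD1 l)//= addrCA lerDl addr_ge0// sumr_ge0.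
pose N : R := n.+1%:R.
have N1 : 1 <= N by rewrite ler1n.
(* With radius [1 / (2 N W)] each coefficient has error at most [s / (2 N)]; there are at most [N]
   of them, so the total error is at most [s / 2]. *)
have k0 : 0 < 2 * N * W by nra.
exists (2 * N * W) => // v vv0 c; pose s : R := \sum_(i in T) `|c i|; rewrite -/s.
set u := \sum_(i in T) c i *: v i.
have cV (l : 'I_#|T|) : `|c (enum_val l)| <= W * `|u| + (2 * N)^-1 * s.
  have -> : c (enum_val l) = ip u (w l) -
      \sum_(i in T) c i * ip (v i - v0 i) (w l).
    rewrite ip_suml// -sumrB big_enum_val (bigD1 l)//= big1 => [|k kl]; last first.
      rewrite ipZ -mulrBr -[X in ip X _ - _](subrK (v0 (enum_val k))) ipD wP.
      by rewrite (negPf kl) addr0 subrr mulr0.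
    rewrite ipZ -mulrBr -[X in ip X _ - _](subrK (v0 (enum_val l))) ipD wP eqxx.
    by rewrite /= addrAC subrr add0r mulr1 addr0.
  apply: le_trans (ler_normB _ _) _; apply: lerD.
    apply: le_trans (cauchy_schwarz _ _ hip) _.
    by rewrite mulrC ler_wpM2r.
  apply: le_trans (ler_norm_sum _ _ _) _; rewrite mulr_sumr.
  apply: ler_sum => i _; rewrite normrM mulrC ler_wpM2r//.
  apply: le_trans (cauchy_schwarz _ _ hip) _.
  apply: le_trans (ler_pM _ _ (vv0 i) (wW l)) _ => //.
  by rewrite invfM mulfVK// gt_eqF// (lt_le_trans ltr01).
have : s <= N * (W * `|u| + (2 * N)^-1 * s).
  have s0 : 0 <= W * `|u| + (2 * N)^-1 * s.
    by rewrite addr_ge0 ?mulr_ge0 ?invr_ge0 ?sumr_ge0 ?mulr_ge0 //; lra.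
  apply: (@le_trans _ _ (\sum_(l < #|T|) (W * `|u| + (2 * N)^-1 * s))).
    by rewrite {1}/s big_enum_val; apply: ler_sum => l _; exact: cV.
  rewrite sumr_const card_ord -[X in X <= _]mulr_natl ler_wpM2r// ler_nat.
  by rewrite (leq_trans (max_card _))// card_ord.
have -> : N * (W * `|u| + (2 * N)^-1 * s) = N * W * `|u| + s / 2.
  by field; lra.
lra.
Qed.

(** There are finitely many [T], and enlarging [k] both weakens the bound and shrinks the radius, so
    the sum of the individual constants serves all [T]. *)
Lemma lin_indep_coef_le_uniform {R : realType} {H : normedModType R}
    {ip : H -> H -> R} {n : nat} (v0 : 'I_n -> H) :
  is_inner_product ip ->
  exists2 k : R, 0 < k & forall v, (forall i, `|v i - v0 i| <= k^-1) ->
    forall (T : {set 'I_n}) (c : 'I_n -> R), lin_indep v0 T ->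
      \sum_(i in T) `|c i| <= k * `|\sum_(i in T) c i *: v i|.
Proof.
move=> hip.
have /choice[k kP] : forall T : {set 'I_n}, exists k : R, 0 < k /\
    (lin_indep v0 T -> forall v, (forall i, `|v i - v0 i| <= k^-1) ->
      forall c : 'I_n -> R, \sum_(i in T) `|c i| <= k * `|\sum_(i in T) c i *: v i|).
  move=> T; have [vT|nvT] := pselect (lin_indep v0 T); last by exists 1; split.
  by have [k k0 kP] := lin_indep_coef_le v0 T hip vT; exists k; split.
have kk T : k T <= \sum_T' k T'.
  by rewrite (bigD1 T)//= lerDl sumr_ge0// => T' _; rewrite ltW//; case: (kP T').
have k0 : 0 < \sum_T' k T'.
  by apply: lt_le_trans (kk finset.set0); case: (kP finset.set0).
exists (\sum_T' k T') => // v vv0 T c vT; have [kT0 /(_ vT v) h] := kP T.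
apply: le_trans (h _ c) _ => [i|]; last by rewrite ler_wpM2r.
by apply: le_trans (vv0 i) _; rewrite lef_pV2 ?posrE.
Qed.

(** * Ekeland's variational principle *)

Lemma ekeland {R : realType} {H : completeNormedModType R}
    (f : H -> R) (a : H) (e : R) :
  continuous f -> (forall x, 0 <= f x) -> 0 < e ->
  exists2 z, f z + e * `|z - a| <= f a &
    forall w, f w + e * `|w - z| <= f z -> w = z.
Proof.
move=> cf f0 e0.
pose P z w := f w + e * `|w - z| <= f z.
have Pxx z : P z z by rewrite /P subrr normr0 mulr0 addr0.
have Ptr x y z : P x y -> P y z -> P x z.
  rewrite /P => xy yz; have := ler_normD (z - y) (y - x); rewrite addrA subrK.
  by nra.
have Pf z w : P z w -> f w <= f z.
  by apply: le_trans; rewrite lerDl mulr_ge0// ltW.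
(* Among the points below [z] in the order [P], [nx z] at least halves the gap between [f z] and the
   infimum of [f]. *)
have /choice[nx nxP] : forall z, exists w,
    P z w /\ forall w', P z w' -> 2 * f w <= f z + f w'.
  move=> z; pose E := f @` P z.
  have Elb : has_lbound E by exists 0 => _ [w _ <-].
  have Einf : has_inf E by split=> //; exists (f z), z.
  have Ele w : P z w -> inf E <= f w by move=> Pw; apply: ge_inf => //; exists w.
  have [fz|fz] := leP (f z) (inf E).
    by exists z; split=> // w /Ele; lra.
  have [|_ [w Pw <-] wE] := @inf_adherent _ E ((f z - inf E) / 2) _ Einf.
    by rewrite divr_gt0// subr_gt0.
  by exists w; split=> // w' /Ele; lra.
pose u k := iter k nx a.
have Pu k l : (k <= l)%N -> P (u k) (u l).
  elim: l => [|l IH]; first by rewrite leqn0 => /eqP->.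
  rewrite leq_eqVlt => /predU1P[->//|/IH kl].
  by apply: Ptr kl _; case: (nxP (u l)).
have fu_cvg : cvgn (f \o u).
  apply: nonincreasing_is_cvgn => [k l /Pu/Pf//|].
  by exists 0 => _ [k _ <-] /=.
have fuL k : limn (f \o u) <= f (u k).
  by apply: (nonincreasing_cvgn_ge _ fu_cvg) => i j /Pu/Pf.
(* Distances along the sequence are controlled by the decrease of [f], which is bounded by its gap
   to the limit. *)
have u_cvg : cvgn u.
  apply/cauchy_cvgP/cauchy_exP => eps eps0.
  have : \forall k \near \oo, f (u k) < limn (f \o u) + e * eps.
    by apply: (cvgr_lt _ fu_cvg); rewrite ltrDl mulr_gt0.
  move=> [N _ /(_ N (leqnn N)) fN]; exists (u N); exists N => // k /= /Pu.
  rewrite /P => h; rewrite -ball_normE /= distrC.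
  by have := fuL k; rewrite -(ltr_pM2l e0); lra.
pose z := limn u.
have fuz : f (u k) @[k --> \oo] --> f z by apply: (cvg_comp _ _ u_cvg); exact: cf.
have Puz k : P (u k) z.
  have h : f (u l) + e * `|u l - u k| @[l --> \oo] --> f z + e * `|z - u k|.
    apply: cvgD => //; apply: cvgM; first exact: cvg_cst.
    by apply: cvg_norm; apply: cvgB => //; exact: cvg_cst.
  by apply: (cvgr_to_le h); exists k => // l /= /Pu.
exists z => [|w Pzw]; first exact: (Puz 0).
(* Any [w] below [z] is below every [u k], so the halving inequality passes to the limit; combined
   with [P z w] it leaves no room for [|w - z| > 0]. *)
have fzw : f z <= f w.
  have h : (2 * f (u k.+1) - f (u k)) @[k --> \oo] --> 2 * f z - f z.
    apply: cvgB => //; apply: cvgM; first exact: cvg_cst.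
    by rewrite (cvg_shiftS (f \o u)).
  have : 2 * f z - f z <= f w.
    apply: (cvgr_to_le h); near=> k; rewrite lerBlDl.
    by have [_ ->] := nxP (u k); last exact: Ptr (Puz k) _.
  by lra.
apply/eqP; rewrite -subr_eq0 -normr_le0 -(pmulr_rle0 _ e0).
by rewrite /P in fzw Pzw; lra.
Unshelve. all: by end_near.
Qed.

(** * Directional derivatives and the mean value theorem *)

Lemma grad_cvg {R : realType} {H : normedModType R} {ip : H -> H -> R}
    {f : H -> R} {g : H -> H} (x d : H) :
  differentiable f x -> ('d f x : H -> R) = ip (g x) ->
  t^-1 * (f (x + t *: d) - f x) @[t --> 0^'] --> ip (g x) d.
Proof.
move=> df dE; have := @diff_derivable _ _ _ f x d df.
rewrite -dE -deriveE // => /cvg_ex[l lP].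
rewrite /derive (cvg_lim _ lP)//; apply: cvg_trans lP.
by apply: near_eq_cvg; near=> t; rewrite /= [_ + x]addrC.
Unshelve. all: by end_near.
Qed.

Lemma mean_value {R : realType} {H : normedModType R} {ip : H -> H -> R}
    {f : H -> R} {g : H -> H} (x y : H) :
  (forall z, differentiable f z /\ ('d f z : H -> R) = ip (g z)) ->
  exists2 t : R, 0 <= t <= 1 &
    f y - f x = ip (g (x + t *: (y - x))) (y - x).
Proof.
move=> gf; pose phi (t : R) := f (x + t *: (y - x)).
have dphi t : is_derive t (1 : R) phi (ip (g (x + t *: (y - x))) (y - x)).
  have [df dE] := gf (x + t *: (y - x)).
  have h : s^-1 *: ((phi \o shift t) (s *: (1 : R)) - phi t) @[s --> 0^'] -->
      ip (g (x + t *: (y - x))) (y - x).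
    apply: cvg_trans (@grad_cvg _ _ ip f g _ (y - x) df dE).
    apply: near_eq_cvg; near=> s => /=.
    have xE : x + (s *: (1 : R) + t) *: (y - x) = x + t *: (y - x) + s *: (y - x).
      by rewrite [s *: _]mulr1 scalerDl [_ *: _ + _ *: _]addrC addrA.
    by rewrite /phi /= xE.
  split; first by apply/cvg_ex; eexists; exact: h.
  exact: (cvg_lim _ h).
have cphi : {within `[0, 1], continuous phi}.
  apply: continuous_subspaceT => t; apply: differentiable_continuous.
  by apply/derivable1_diffP; case: (dphi t).
have [t t01] := MVT_segment (@ler01 R) (fun t _ => dphi t) cphi.
rewrite subr0 mulr1 /phi scale0r addr0 scale1r [x + (y - x)]addrC subrK => ->.
by exists t => //; move: t01; rewrite in_itv.
Unshelve. all: by end_near.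
Qed.

(** * The quadratic penalty and its approximate stationarity *)

(** Equality constraints keep their sign, so that [k * violation] is directly the multiplier in the
    gradient of the penalty. *)
Definition violation {R : realType} {H : normedModType R} {n : nat} (m : nat)
  (f : 'I_n -> H -> R) (i : 'I_n) (z : H) : R :=
  if (i < m)%N then Num.max 0 (f i z) else f i z.

(** Majorises the squared positive part by the square of an expression affine in the increment of
    [f i], so that the maximum never has to be differentiated. *)
Lemma sqr_violation_le {R : realType} {H : normedModType R} {n : nat} (m : nat)
    (f : 'I_n -> H -> R) (i : 'I_n) (z w : H) :
  violation m f i w ^+ 2 <= (violation m f i z + (f i w - f i z)) ^+ 2.
Proof.
rewrite /violation; case: ifP => _; last by rewrite addrC subrK.
case: (leP 0 (f i w)) => w0; last by rewrite expr0n sqr_ge0.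
case: (leP 0 (f i z)) => z0; first by rewrite addrC subrK.
by rewrite add0r ler_sqr ?nnegrE ?subr_ge0; lra.
Qed.

Definition penalty {R : realType} {H : normedModType R} {n : nat} (m : nat)
  (f : 'I_n -> H -> R) (k : R) (x w : H) : R :=
  `|w - x| ^+ 2 / 2 + k / 2 * \sum_i violation m f i w ^+ 2.

(** The vector [u] is the formal gradient of the penalty at [z]. Moving from [z] in the direction
    [-u] gives [0 <= - |u|^2 + e |u|] in the limit. *)
Lemma penalty_stationary {R : realType} {H : normedModType R}
    {ip : H -> H -> R} {n : nat} (m : nat) (f : 'I_n -> H -> R)
    (g : 'I_n -> H -> H) (k e : R) (x z : H) :
  is_inner_product ip ->
  (forall i, differentiable (f i) z /\ ('d (f i) z : H -> R) = ip (g i z)) ->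
  0 <= k -> 0 <= e ->
  (forall w, penalty m f k x z <= penalty m f k x w + e * `|w - z|) ->
  `|z - x + \sum_i (k * violation m f i z) *: g i z| <= e.
Proof.
move=> hip gf k0 e0 zmin; have [ipD ipZ _ ipZr] := ip_props hip.
have [ipC _ ipN] := hip.
set u := z - x + _; pose d := - u.
pose q i t : R := t^-1 * (f i (z + t *: d) - f i z).
(* [B t] bounds from above the increment of the penalty plus the [e] term, divided by [t]. *)
pose B t : R := ip (z - x) d + t * (`|d| ^+ 2 / 2) +
   k * (\sum_i (violation m f i z * q i t + t * (q i t ^+ 2 / 2))) + e * `|d|.
have B0 : \forall t \near 0^'+, 0 <= B t.
  near=> t; have t0 : 0 < t by near: t; exact: nbhs_right_gt.
  have := zmin (z + t *: d); rewrite -(pmulr_rge0 _ t0) /penalty.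
  have -> : z + t *: d - z = t *: d by rewrite addrC addKr.
  have -> : z + t *: d - x = (z - x) + t *: d by rewrite addrAC.
  rewrite (ip_normD (z - x) (t *: d) hip) ipZr normrZ (gtr0_norm t0).
  have : \sum_i violation m f i (z + t *: d) ^+ 2 <=
    \sum_i violation m f i z ^+ 2 +
    t * (2 * \sum_i (violation m f i z * q i t + t * (q i t ^+ 2 / 2))).
    rewrite !mulr_sumr -big_split /=; apply: ler_sum => i _.
    apply: le_trans (sqr_violation_le m f i z _) _.
    have -> : f i (z + t *: d) - f i z = t * q i t.
      by rewrite /q mulrA mulfV ?mul1r// gt_eqF.
    by rewrite le_eqVlt; apply/orP; left; apply/eqP; field.
  rewrite /B; set s1 := \sum_i _; set s2 := \sum_i _; set s3 := \sum_i _.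
  move: (ip _ _) (`|d|) (`|z - x|) => a b c s12.
  have : k / 2 * s1 <= k / 2 * (s2 + t * (2 * s3)) by rewrite ler_wpM2l// divr_ge0.
  by rewrite exprMn; nra.
(* The vanishing terms are kept with an explicit factor 0, so that the limit of [B] is computed term
   by term. *)
pose L := ip (z - x) d + 0 * (`|d| ^+ 2 / 2) +
   k * (\sum_i (violation m f i z * ip (g i z) d + 0 * (ip (g i z) d ^+ 2 / 2)))
   + e * `|d|.
have Bcvg : B t @[t --> 0^'+] --> L.
  have t0 : (t : R) @[t --> (0 : R)^'+] --> (0 : R).
    exact: cvg_at_right_filter.
  have qc i : q i t @[t --> 0^'+] --> ip (g i z) d.
    apply: cvg_dnbhs_at_right; have [df dE] := gf i.
    exact: (@grad_cvg _ _ ip (f i) (g i)).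
  apply: cvgD; last exact: cvg_cst.
  apply: cvgD; first by apply: cvgD; [exact: cvg_cst|apply: cvgMl].
  apply: cvgM; first exact: cvg_cst.
  apply: cvg_big => [|i _]; first exact: add_continuous.
  apply: cvgD; first by apply: cvgM => //; exact: cvg_cst.
  by apply: cvgM => //; apply: cvgM; [exact: cvgM|exact: cvg_cst].
have : 0 <= L by apply: (cvgr_to_ge Bcvg B0).
have -> : L = - `|u| ^+ 2 + e * `|d|.
  rewrite /L -(ipN u) -mulN1r -ipZr scaleN1r -/d [in RHS]/u [in RHS]ipD.
  rewrite mul0r addr0; congr (_ + _ + _).
  rewrite ip_suml// mulr_sumr; apply: eq_bigr => i _.
  by rewrite ipZ mul0r addr0 mulrA.
rewrite normrN addrC subr_ge0 expr2.
have [->|u0] := eqVneq u 0; first by rewrite normr0.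
have u1 : 0 < `|u| by rewrite normr_gt0.
by rewrite (ler_pM2r u1).
Unshelve. all: by end_near.
Qed.

(** * Multiplier reduction under constant rank *)

(** After reduction [T0 :|: K'] is independent for [v], so [S0 :|: K'] has rank at least its size,
    for [v] and hence for [v0]. For [v0] it also spans [S0 :|: K'], so it is independent there and
    [coef] applies. *)
Lemma constant_rank_multipliers {R : realType} {H : normedModType R} {n : nat}
    (v0 v : 'I_n -> H) (S0 T0 K : {set 'I_n}) (k : R) (c : 'I_n -> R) :
  (forall (T : {set 'I_n}) (a : 'I_n -> R), lin_indep v0 T ->
    \sum_(i in T) `|a i| <= k * `|\sum_(i in T) a i *: v i|) ->
  (forall K' : {set 'I_n}, K' \subset K ->
    fam_rank v (S0 :|: K') = fam_rank v0 (S0 :|: K')) ->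
  T0 \subset S0 -> lin_indep v0 T0 -> #|T0| = fam_rank v0 S0 ->
  (forall i, i \in K -> i \notin S0) ->
  (forall i, i \in K -> 0 <= c i) ->
  exists (K' : {set 'I_n}) (c' : 'I_n -> R),
    [/\ K' \subset K, (forall i, i \in K' -> 0 <= c' i),
      \sum_(i in T0 :|: K') c' i *: v i = \sum_(i in S0 :|: K) c i *: v i
    & \sum_(i in T0 :|: K') `|c' i| <= k * `|\sum_(i in S0 :|: K) c i *: v i|].
Proof.
move=> coef rk TS v0T rT KS c0.
(* Applied to a vanishing combination, [coef] forces all coefficients to be zero. *)
have vT : lin_indep v T0.
  move=> a a0 i iT; have := coef _ a v0T; rewrite a0 normr0 mulr0.
  rewrite (bigD1 i)//= => h; apply/eqP; rewrite -normr_le0.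
  by apply: le_trans h; rewrite lerDl sumr_ge0.
have KT i : i \in K -> i \notin T0.
  by move=> /KS; apply: contra; exact: (fintype.subsetP TS).
have rS : fam_rank v S0 = #|T0|.
  by rewrite rT; have := rk finset.set0; rewrite finset.setU0 finset.sub0set; exact.
have [a aP] := fam_rank_span v S0 T0 TS vT (eq_leq rS).
have [a0 a0P] := fam_rank_span v0 S0 T0 TS v0T (eq_leq (esym rT)).
(* The part of the combination over [S0] is rewritten in the basis [T0] of its span; the
   coefficients on [K] are untouched. *)
pose c1 j := if j \in T0 then \sum_(i in S0) c i * a i j else c j.
have sumU (A : {set 'I_n}) (b : 'I_n -> R) : (forall i, i \in K -> i \notin A) ->
    \sum_(i in A :|: K) b i *: v i =
    \sum_(i in A) b i *: v i + \sum_(i in K) b i *: v i.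
  move=> KA; rewrite [LHS]big_mkcond [X in X + _]big_mkcond [X in _ + X]big_mkcond.
  rewrite -big_split /=; apply: eq_bigr => i _; rewrite inE.
  have := KA i; case: (i \in K); last by rewrite orbF addr0.
  by move=> /(_ isT)/negPf->; rewrite add0r.
have c1E : \sum_(i in T0 :|: K) c1 i *: v i = \sum_(i in S0 :|: K) c i *: v i.
  rewrite !sumU//; congr (_ + _); last first.
    by apply: eq_bigr => i iK; rewrite /c1 (negPf (KT _ iK)).
  transitivity (\sum_(j in T0) \sum_(i in S0) (c i * a i j) *: v j).
    by apply: eq_bigr => j jT; rewrite /c1 jT scaler_suml.
  rewrite exchange_big /=; apply: eq_bigr => i iS.
  by rewrite aP// scaler_sumr; apply: eq_bigr => j _; rewrite scalerA.
have [||K' [c' [K'K vK' c'0 c'E]]] := caratheodory v T0 K c1 vT.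
- exact: KT.
- by move=> i iK; rewrite /c1 (negPf (KT _ iK)) c0.
exists K', c'; split=> //; first by rewrite c'E.
rewrite -c1E -c'E; apply: coef.
pose b i j : R := if i \in S0 then (if j \in T0 then a0 i j else 0)
  else (j == i)%:R.
apply: (lin_indep_of_span _ (S0 :|: K') _ b) => [i|]; last first.
  by rewrite -rk//; apply: fam_rank_ge => //; exact: finset.setSU.
rewrite inE /b; case: (boolP (i \in S0)) => [iS _|iS /= iK].
  rewrite a0P// [LHS]big_mkcond [RHS]big_mkcond /=; apply: eq_bigr => j _.
  by rewrite inE; case: (j \in T0) => //=; case: ifP; rewrite // scale0r.
rewrite (bigD1 i)/= ?inE ?iK ?orbT// eqxx scale1r big1 ?addr0// => j /andP[_].
by move=> /negPf->; rewrite scale0r.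
Qed.

(** * Elementary properties of the residual *)

Lemma violation_feasible {R : realType} {G H : normedModType R} {m n : nat}
    {h : 'I_n -> G -> H -> R} {p : G} {x : H} (i : 'I_n) :
  feasible_map m h p x -> violation m (h^~ p) i x = 0.
Proof.
move=> [hI hE]; rewrite /violation; case: ifP => im; first by rewrite max_l// hI.
by rewrite hE// leqNgt im.
Qed.

Lemma residual_ge0 {R : realType} {G H : normedModType R} (m n : nat)
    (h : 'I_n -> G -> H -> R) (p : G) (x : H) : 0 <= residual m h p x.
Proof. by rewrite /residual; exact: bigmax_ge_id. Qed.

Lemma residual_ge {R : realType} {G H : normedModType R} (m n : nat)
    (h : 'I_n -> G -> H -> R) (p : G) (x : H) (i : 'I_n) :
  (if (i < m)%N then h i p x else `|h i p x|) <= residual m h p x.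
Proof.
exact: (@le_bigmax_cond _ R _ 0 i xpredT
  (fun i : 'I_n => if (i < m)%N then h i p x else `|h i p x|) _).
Qed.

Lemma residual_le {R : realType} {G H : normedModType R} (m n : nat)
    (h : 'I_n -> G -> H -> R) (p : G) (x : H) (e : R) : 0 <= e ->
  (forall i : 'I_n, (if (i < m)%N then h i p x else `|h i p x|) <= e) ->
  residual m h p x <= e.
Proof. by move=> e0 he; apply/bigmax_leP; split. Qed.

Lemma residual_eq0 {R : realType} {G H : normedModType R} {m n : nat}
    {h : 'I_n -> G -> H -> R} {p : G} {x : H} :
  residual m h p x <= 0 -> feasible_map m h p x.
Proof.
move=> r0; split=> i im; have := le_trans (residual_ge m n h p x i) r0.
  by rewrite im.
by rewrite ltnNge im normr_le0 => /eqP.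
Qed.

Lemma residual_continuous {R : realType} {G H : normedModType R} {m n : nat}
    {h : 'I_n -> G -> H -> R} (p : G) :
  (forall i, continuous (h i p)) -> continuous (residual m h p).
Proof.
move=> hc x; apply: cvg_big => [|i _].
  by move=> q; apply: (@continuous_max R _ fst snd q);
    [exact: cvg_fst|exact: cvg_snd].
by case: ifP => _; [exact: hc|apply: cvg_norm; exact: hc].
Qed.

(** * The descent step *)

(** Constant rank enters only through the multiplier hypothesis, whose bound [k] does not depend on
    the penalty parameter; this makes the final constant uniform in [x] and [p]. *)
Lemma penalty_step {R : realType} {G : normedModType R}
    {H : completeNormedModType R} {ip : H -> H -> R} {m n : nat}
    {h : 'I_n -> G -> H -> R} {gh : 'I_n -> G -> H -> H}
    (p : G) (x0 xf x : H) (r k : R) :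
  is_inner_product ip -> (forall i, continuous (h i p)) ->
  (forall i, is_partial_gradient ip (h i) (gh i)) -> 0 < k ->
  (forall i z z', `|z - x0| < r -> `|z' - x0| < r ->
    `|gh i p z - gh i p z'| <= (4 * k)^-1) ->
  (forall z (K : {set 'I_n}) (c : 'I_n -> R), `|z - x0| < r ->
    (forall i, i \in K -> (i < m)%N && (0 < h i p z)) ->
    (forall i, i \in K -> 0 <= c i) ->
    exists (T K' : {set 'I_n}) (c' : 'I_n -> R),
    [/\ T \subset eq_indices m n, K' \subset K, (forall i, i \in K' -> 0 <= c' i),
      \sum_(i in T :|: K') c' i *: gh i p z =
      \sum_(i in eq_indices m n :|: K) c i *: gh i p z
    & \sum_(i in T :|: K') `|c' i| <=
      k * `|\sum_(i in eq_indices m n :|: K) c i *: gh i p z| ]) ->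
  feasible_map m h p xf -> `|xf - x0| < r / 4 -> `|x - x0| < r / 4 ->
  0 < residual m h p x ->
  exists2 w, residual m h p w <= residual m h p x / 2 &
    `|w - x| <= (6 * k + 2) * residual m h p x.
Proof.
move=> hip hc gradh k0 gh_near mult xfF xf0 xx0 psi0.
set psi := residual m h p x in psi0 *; have [ipD ipZ ipDr ipZr] := ip_props hip.
have [_ _ ipN] := hip.
pose f i z := h i p z; pose viol := violation m f.
(* Large enough that a point whose penalty does not exceed that of [xf] has all violations at most
   [psi / 2]; the summand 1 keeps it positive when [xf = x]. *)
pose kk := 1 + `|xf - x| ^+ 2 / (psi / 2) ^+ 2.
have kk1 : 1 <= kk by rewrite lerDl divr_ge0// exprn_ge0// ?divr_ge0// ltW.
have kkge : `|xf - x| ^+ 2 <= kk * (psi / 2) ^+ 2.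
  rewrite mulrDl mulfVK ?lerDr ?mul1r ?exprn_ge0 ?divr_ge0 ?ltW//.
  by rewrite sqrf_eq0 gt_eqF// divr_gt0.
have cPhi : continuous (penalty m f kk x).
  have cv i : continuous (viol i).
    move=> z; rewrite /viol /violation; case: (ltnP i m) => im; last exact: hc.
    by apply: continuous_max; [exact: cvg_cst|exact: hc].
  move=> z; apply: cvgD.
    apply: cvgM; last exact: cvg_cst.
    have nz : `|w - x| @[w --> z] --> `|z - x|.
      by apply: cvg_norm; apply: cvgB; [exact: cvg_id|exact: cvg_cst].
    by rewrite expr2; apply: cvgM.
  apply: cvgM; first exact: cvg_cst.
  apply: cvg_big => [|i _]; first exact: add_continuous.
  by rewrite expr2; apply: cvgM; exact: cv.
have viol2 w : 0 <= \sum_i viol i w ^+ 2 by apply: sumr_ge0 => i _; rewrite sqr_ge0.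
have Phi0 w : 0 <= penalty m f kk x w.
  by rewrite addr_ge0 ?mulr_ge0 ?exprn_ge0 ?invr_ge0//; lra.
have [z zxf zmin] := ekeland (penalty m f kk x) xf psi cPhi Phi0 psi0.
have zPhi : `|z - x| ^+ 2 / 2 + kk / 2 * \sum_i viol i z ^+ 2 <=
    `|xf - x| ^+ 2 / 2.
  apply: le_trans (_ : penalty m f kk x xf <= _); last first.
    rewrite /penalty big1 ?mulr0 ?addr0// => i _.
    by rewrite (violation_feasible i xfF) expr0n.
  by apply: le_trans zxf; rewrite lerDl mulr_ge0// ltW.
have zx : `|z - x| <= `|xf - x|.
  rewrite -(ler_pXn2r (n := 2)) ?nnegrE//.
  by have := mulr_ge0 (_ : 0 <= kk) (viol2 z); lra.
(* Three distances below [r / 4] add up: from [z] to [x] is at most from [xf] to [x], and then from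
   [x] to [x0]. *)
have zr' : `|z - x0| <= 3 * r / 4.
  have zxx : `|z - x0| <= `|z - x| + `|x - x0| by exact: ler_distD.
  have xfx : `|xf - x| <= `|xf - x0| + `|x - x0|.
    by rewrite (distrC x); exact: ler_distD.
  by have := normr_ge0 (x - x0); lra.
have zr : `|z - x0| < r by have := normr_ge0 (x - x0); lra.
have xr : `|x - x0| < r by have := normr_ge0 (x - x0); lra.
have violz i : `|viol i z| <= psi / 2.
  have psi2 : 0 <= psi / 2 by rewrite divr_ge0// ltW.
  rewrite -(ler_pXn2r (n := 2)) ?nnegrE// real_normK ?num_real//.
  have : viol i z ^+ 2 <= \sum_i viol i z ^+ 2.
    by rewrite (bigD1 i)//= lerDl sumr_ge0// => j _; rewrite sqr_ge0.
  move=> h1; rewrite -(ler_pM2l (_ : 0 < kk)); last lra.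
  have : kk * viol i z ^+ 2 <= kk * \sum_i viol i z ^+ 2 by rewrite ler_wpM2l//; lra.
  by have := sqr_ge0 `|z - x|; lra.
exists z.
  apply: residual_le => [|i]; first by rewrite divr_ge0// ltW.
  apply: le_trans (violz i); rewrite /viol /violation /f; case: ifP => // _.
  by apply: le_trans (ler_norm _); rewrite le_max lexx orbT.
(* If [D <= psi] the bound is immediate; otherwise [psi < D] will give [D + psi <= 2 * D]. *)
set D := `|z - x|; have [Dpsi|psiD] := leP D psi.
  by apply: le_trans Dpsi _; rewrite ler_peMl// ltW//; lra.
set e := z - x + \sum_i (kk * viol i z) *: gh i p z.
have epsi : `|e| <= psi.
  apply: (penalty_stationary m f (fun i => gh i p) kk psi x z hip).
  - by move=> i; exact: gradh.
  - by lra.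
  - exact: ltW.
  - move=> w; have [->|wz] := eqVneq w z.
      by rewrite subrr normr0 mulr0 addr0.
    by rewrite leNgt; apply/negP => /ltW /zmin wE; rewrite wE eqxx in wz.
pose K := [set i : 'I_n | (i < m)%N && (0 < h i p z)]%SET.
have [i|i|T [K' [c [TS K'K c0 cE cle]]]] :=
    mult z K (fun i => kk * viol i z) zr.
- by rewrite inE.
- rewrite inE => /andP[im hi]; rewrite /viol /violation im mulr_ge0//; first lra.
  by rewrite le_max lexx.
set u := \sum_(i in eq_indices m n :|: K) _ in cE cle.
have uE : u = \sum_i (kk * viol i z) *: gh i p z.
  rewrite /u big_mkcond; apply: eq_bigr => i _; case: ifPn => //.
  rewrite /eq_indices !inE leqNgt /viol /violation; case: (i < m)%N => //=.
  by rewrite -leNgt /f => hi; rewrite max_l// mulr0 scale0r.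
have eE : x - z = u - e by rewrite /e -uE opprD addrCA subrr addr0 opprB.
have uD : `|u| <= D + psi.
  have -> : u = (x - z) + e by rewrite eE subrK.
  by apply: le_trans (ler_normD _ _) _; rewrite distrC lerD2l.
(* The three terms bound the constraint value at [x], the violation at [z] and the linearisation
   error. *)
pose B := psi + psi / 2 + (4 * k)^-1 * D.
have D0 : 0 <= D by exact: normr_ge0.
have lin i : `|h i p x - h i p z - ip (gh i p z) (x - z)| <= (4 * k)^-1 * D.
  have [t /andP[t0 t1] ->] := mean_value z x (gradh i p).
  rewrite -mulN1r -ipZ scaleN1r -ipD.
  apply: le_trans (cauchy_schwarz _ _ hip) _.
  rewrite [`|x - z|]distrC ler_wpM2r//; apply: gh_near => //.
  have -> : z + t *: (x - z) - x0 = (1 - t) *: (z - x0) + t *: (x - x0).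
    rewrite scalerBl scale1r -[RHS]addrA [- (_ *: _) + _]addrC -scalerBr opprB.
    by rewrite [x - x0 + _]addrA subrK addrAC.
  apply: le_lt_trans (ler_normD _ _) _; rewrite !normrZ !ger0_norm ?subr_ge0//.
  have : (1 - t) * `|z - x0| <= (1 - t) * (3 * r / 4).
    by rewrite ler_wpM2l// subr_ge0.
  have : t * `|x - x0| <= t * (3 * r / 4) by rewrite ler_wpM2l//; lra.
  by have := normr_ge0 (x - x0); lra.
(* On equality constraints both signs are controlled. On [K'] the multiplier is nonnegative and
   [h i p z > 0], so the upper bound on [h i p x] suffices. *)
have term i : i \in T :|: K' -> c i * ip (gh i p z) (x - z) <= `|c i| * B.
  have := lin i; rewrite ler_norml => /andP[l1 l2].
  rewrite inE => /orP[/(fintype.subsetP TS)|iK'].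
    rewrite /eq_indices inE => mi; apply: le_trans (ler_norm _) _; rewrite normrM ler_wpM2l//.
    have := residual_ge m n h p x i; have := violz i.
    rewrite /viol /violation /f ltnNge mi /= -/psi !ler_norml /B.
    by move=> /andP[a1 a2] /andP[b1 b2]; apply/andP; split; lra.
  rewrite ger0_norm ?c0// ler_wpM2l ?c0//.
  have := fintype.subsetP K'K _ iK'; rewrite inE => /andP[im hi].
  have := residual_ge m n h p x i; rewrite im -/psi /B; lra.
have B0 : 0 <= B.
  by rewrite /B !addr_ge0 ?mulr_ge0 ?invr_ge0 ?ltW//; lra.
have DB : D ^+ 2 <= k * (D + psi) * B + psi * D.
  have -> : D ^+ 2 = ip (x - z) (x - z) by rewrite ipN distrC.
  rewrite [X in ip X _]eE ipD; apply: lerD.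
    rewrite -cE ip_suml//.
    under eq_bigr do rewrite ipZ.
    apply: le_trans (ler_sum _ term) _; rewrite -mulr_suml ler_wpM2r//.
    by apply: le_trans cle _; rewrite ler_wpM2l// ltW.
  apply: le_trans (ler_norm _) _; apply: le_trans (cauchy_schwarz _ _ hip) _.
  by rewrite normrN [`|x - z|]distrC ler_wpM2r.
have {DB} : D * D <= D * (k * 2 * B + psi).
  apply: le_trans (_ : k * (D + psi) * B + psi * D <= _); first by rewrite -expr2.
  have : (D + psi) * (k * B) <= (2 * D) * (k * B).
    have kB : 0 <= k * B by rewrite mulr_ge0// ltW.
    by rewrite ler_wpM2r//; lra.
  by lra.
rewrite ler_pM2l ?(lt_trans psi0)//.
(* The gradient oscillation [1 / (4 k)] was chosen so that the linearisation error contributes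
   exactly [D / 2], which is absorbed. *)
have -> : k * 2 * B + psi = 3 * k * psi + D / 2 + psi by rewrite /B; field; lra.
by lra.
Qed.

(** * Choice of neighbourhoods and the error bound *)

Lemma near_pair_ball {R : realType} {G H : normedModType R} {p0 : G} {x0 : H}
    {Q : G * H -> Prop} : (\forall q \near (p0, x0), Q q) ->
  exists2 r : R, 0 < r &
    forall p x, `|p - p0| < r -> `|x - x0| < r -> Q (p, x).
Proof.
move=> /nbhs_ballP[r r0 rQ]; exists r => // p x pr xr; apply: rQ.
by split; rewrite -ball_normE /= distrC.
Qed.

Lemma near_residual_le {R : realType} {G H : normedModType R} {m n : nat}
    {h : 'I_n -> G -> H -> R} {p0 : G} {x0 : H} (e : R) :
  (forall i, continuous (fun q : G * H => h i q.1 q.2)) ->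
  feasible_map m h p0 x0 -> 0 < e ->
  \forall q \near (p0, x0), residual m h q.1 q.2 <= e.
Proof.
move=> hc [hI hE] e0.
have : forall i : 'I_n, \forall q \near (p0, x0),
    (if (i < m)%N then h i q.1 q.2 else `|h i q.1 q.2|) <= e.
  move=> i; case: (ltnP i m) => im.
    by apply: (cvgr_le _ (hc i (p0, x0))); apply: le_lt_trans e0; exact: hI.
  near=> q; rewrite -normrN -sub0r -(hE i im).
  by near: q; exact: cvgr_dist_le (hc i (p0, x0)) _ e0.
move=> /filter_forall he; near=> q; apply: residual_le; first exact: ltW.
by near: q.
Unshelve. all: by end_near.
Qed.

Theorem theorem14 (R : realType) (G : normedModType R)
  (H : completeNormedModType R) (ip : H -> H -> R)
  (m n : nat) (h : 'I_n -> G -> H -> R) (gh : 'I_n -> G -> H -> H)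
  (p0 : G) (x0 : H) :
  is_inner_product ip ->
  (m <= n)%N ->
  (forall i, continuous (fun q : G * H => h i q.1 q.2)) ->
  (forall i, is_partial_gradient ip (h i) (gh i)) ->
  (forall i, continuous (fun q : G * H => gh i q.1 q.2)) ->
  graph (feasible_map m h) (p0, x0) ->
  lsc_rel (feasible_map m h) (domain (feasible_map m h)) p0 x0 ->
  RCRCQ_rel m h gh (domain (feasible_map m h)) setT p0 x0 ->
  R_regular_rel m h (domain (feasible_map m h)) p0 x0.
Proof.
move=> hip _ hc gradh ghc F0 lsc rcrcq.
have hpc p i : continuous (h i p).
  by move=> x; apply: differentiable_continuous; case: (gradh i p x).
have [k k0 coef] := lin_indep_coef_le_uniform (fun i => gh i p0 x0) hip.
have [T0 [TS vT rT]] := fam_rank_witness (fun i => gh i p0 x0) (eq_indices m n).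
(* Two deviations of [1 / (8 k)] give the oscillation [1 / (4 k)] required by [penalty_step]. *)
have /filter_forall near_gh : forall i, \forall q \near (p0, x0),
    `|gh i q.1 q.2 - gh i p0 x0| <= (8 * k)^-1.
  move=> i; have k8 : 0 < (8 * k)^-1 by rewrite invr_gt0 mulr_gt0.
  near=> q; rewrite distrC; near: q.
  exact: cvgr_dist_le (ghc i (p0, x0)) _ k8.
(* Constraints inactive at the reference point stay negative nearby, so only active ones can be
   violated. *)
have /filter_forall near_h : forall i : 'I_n, \forall q \near (p0, x0),
    (i < m)%N -> 0 < h i q.1 q.2 -> h i p0 x0 = 0.
  move=> i; case: (ltnP i m) => im; last by near=> q.
  have : h i p0 x0 <= 0 by case: F0 => /(_ i im).
  rewrite le_eqVlt => /predU1P[h0|h0]; first by near=> q.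
  near=> q => _ q0; have : h i q.1 q.2 < 0.
    by near: q; exact: cvgr_lt (hc i (p0, x0)) _ h0.
  by move=> /(lt_trans q0); rewrite ltxx.
have /filter_forall near_rank : forall K : {set 'I_n}, \forall q \near (p0, x0),
    K \subset active m h p0 x0 -> domain (feasible_map m h) q.1 ->
    fam_rank (fun i => gh i q.1 q.2) (eq_indices m n :|: K) =
    fam_rank (fun i => gh i p0 x0) (eq_indices m n :|: K).
  move=> K.
  have [KA|nKA] := boolP (K \subset active m h p0 x0); last by near=> q.
  have rK := rcrcq K KA; near=> q => _ qF.
  by have : setT q.2 by []; move: qF; near: q.
have [r r0 rP] := near_pair_ball (filterI near_gh (filterI near_h near_rank)).
pose C := 6 * k + 2; have C0 : 0 < C by rewrite addr_gt0 ?mulr_gt0.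
(* With the residual below this value, Ekeland's point lies within [r / 8] of [x], hence within
   [r / 4] of [x0]. *)
have e0 : 0 < r / 8 / (2 * C) by rewrite !divr_gt0 ?mulr_gt0.
have [r1 r10 r1P] := near_pair_ball (near_residual_le _ hc F0 e0).
have r40 : 0 < r / 4 by rewrite divr_gt0.
have [U U0 UP] := lsc _ (nbhsx_ballx x0 _ r40).
exists (2 * C); split; first by rewrite mulr_gt0.
exists (U `&` ball p0 (Num.min r r1)).
  by apply: filterI => //; apply: nbhsx_ballx; rewrite lt_min r0.
exists (ball x0 (Num.min (r / 8) r1)).
  by apply: nbhsx_ballx; rewrite lt_min r10 divr_gt0.
move=> x p; rewrite -!ball_normE /= lt_min distrC => /andP[xr xr1] [Up].
rewrite /= lt_min distrC => /andP[pr pr1] domp.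
have [xf [xfF]] := UP p Up domp; rewrite -ball_normE /= distrC => xfr.
have psix := r1P p x pr1 xr1; rewrite /= in psix.
have gh_near i z z' : `|z - x0| < r -> `|z' - x0| < r ->
    `|gh i p z - gh i p z'| <= (4 * k)^-1.
  move=> zr z'r; have [/(_ i) /= gz _] := rP p z pr zr.
  have [/(_ i) /= gz' _] := rP p z' pr z'r.
  apply: le_trans (ler_distD (gh i p0 x0) _ _) _.
  rewrite [X in _ + X]distrC; apply: le_trans (lerD gz gz') _.
  by rewrite le_eqVlt; apply/orP; left; apply/eqP; field; lra.
have mult z (K : {set 'I_n}) (c : 'I_n -> R) : `|z - x0| < r ->
    (forall i, i \in K -> (i < m)%N && (0 < h i p z)) ->
    (forall i, i \in K -> 0 <= c i) ->
    exists (T K' : {set 'I_n}) (c' : 'I_n -> R),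
    [/\ T \subset eq_indices m n, K' \subset K, (forall i, i \in K' -> 0 <= c' i),
      \sum_(i in T :|: K') c' i *: gh i p z =
      \sum_(i in eq_indices m n :|: K) c i *: gh i p z
    & \sum_(i in T :|: K') `|c' i| <=
      k * `|\sum_(i in eq_indices m n :|: K) c i *: gh i p z| ].
  move=> zr Kpos c0; have [/= gz [/= hz rz]] := rP p z pr zr.
  have KA : K \subset active m h p0 x0.
    apply/fintype.subsetP => i /Kpos/andP[im hi].
    by rewrite /active inE im /=; apply/asboolP; exact: hz im hi.
  have [|||K' [c' [K'K c'0 c'E c'le]]] := constant_rank_multipliers
      (fun i => gh i p0 x0) (fun i => gh i p z) (eq_indices m n) T0 K k c
      _ _ TS vT rT _ c0.
  - move=> T a vT'; apply: coef => // i; apply: le_trans (gz i) _.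
    by rewrite lef_pV2 ?posrE ?mulr_gt0//; lra.
  - by move=> K' K'K; apply: rz => //; exact: fintype.subset_trans KA.
  - by move=> i /Kpos/andP[im _]; rewrite /eq_indices inE -ltnNge.
  by exists T0, K', c'.
have C20 : 0 < (2 * C)^-1 by rewrite invr_gt0 mulr_gt0.
have [z zx zmin] := ekeland (residual m h p) x _ (residual_continuous p (hpc p))
  (residual_ge0 m n h p) C20.
have zC : `|z - x| <= 2 * C * residual m h p x.
  rewrite -ler_pdivrMl ?mulr_gt0//.
  by apply: le_trans zx; rewrite lerDr residual_ge0.
have zr : `|z - x0| < r / 4.
  have h1 : `|z - x0| <= `|z - x| + `|x - x0| by exact: ler_distD.
  have : 2 * C * residual m h p x <= r / 8.
    by rewrite -ler_pdivlMl ?mulr_gt0// mulrC.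
  by lra.
(* If the residual at [z] were positive, the descent step would halve it at a cost
   [(2 C)^-1 |w - z|] of at most the other half; minimality then gives [w = z], which is absurd. *)
have zF : feasible_map m h p z.
  apply: residual_eq0; rewrite leNgt; apply/negP => psiz.
  have [w wz wD] := penalty_step p x0 xf z r k hip (hpc p) gradh k0 gh_near mult
    xfF xfr zr psiz.
  have wE : w = z.
    apply: zmin; have : (2 * C)^-1 * `|w - z| <= residual m h p z / 2.
      by rewrite invfM -mulrA mulrC ler_pM2r// ler_pdivrMl.
    by lra.
  by move: wz; rewrite wE; lra.
apply: le_trans (_ : `|x - z| <= _); last by rewrite distrC.
apply: ge_inf; last by exists z.
by exists 0 => _ [y _ <-].
Unshelve. all: by end_near.
Qed.
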